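(* Let $q=p^l$ be a prime power ($p$ prime) and $\mathbb{F}_q$ the finite field of order $q$. Let $\mathcal{D}$ be a $1$-$(v,k,r)$ design with blocks $B_1,\ldots,B_b$ and let $d\in\mathbb{F}_p$, $d\neq 0$, be such that $k\equiv 0\pmod p$ and $|B_i\cap B_j|\equiv d\pmod p$ for all $i,j\in\{1,\ldots,b\}$, $i\neq j$. Let $G$ be an automorphism group of $\mathcal{D}$ which acts on $\mathcal{D}$ with $n$ point orbits, all of length $w$, and $m$ block orbits, all of length $w$, and let $O$ be the orbit matrix of $\mathcal{D}$ under the action of $G$. Then: (a) If $p\mid w$, then the linear code spanned by the rows of the matrix $[\sqrt{d}\,I_m,\ O]$ is a self-orthogonal $[m+n,m]$ code over the field $\mathbb{F}$, where $\mathbb{F}=\mathbb{F}_q$ if $d$ is a square in $\mathbb{F}_q$, and $\mathbb{F}=\mathbb{F}_{q^2}$ otherwise. If $m=n$, the obtained code is self-dual. (b) If $p\mid w-1$, then the linear code spanned by the rows of the matrix $[\sqrt{wd}\,I_m,\ O,\ \sqrt{-wd}\,\mathbf{1}]$ is a self-orthogonal $[m+n+1,m]$ code over the field $\mathbb{F}$, where $\mathbb{F}=\mathbb{F}_q$ if $wd$ and $-wd$ are squares in $\mathbb{F}_q$, and $\mathbb{F}=\mathbb{F}_{q^2}$ otherwise. (c) If $p\nmid w$ and $p\nmid w-1$, then the linear code spanned by the rows of the matrix $[\sqrt{d}\,I_m,\ O,\ \sqrt{-wd}\,\mathbf{1}]$ is a self-orthogonal $[m+n+1,m]$ code over the field $\mathbb{F}$,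 where $\mathbb{F}=\mathbb{F}_q$ if $d$ and $-wd$ are squares in $\mathbb{F}_q$, and $\mathbb{F}=\mathbb{F}_{q^2}$ otherwise.
   Context: A $1$-$(v,k,r)$ design is a finite incidence structure with $v$ points and $b$ blocks such that every block is incident with exactly $k$ points and every point is incident with exactly $r$ blocks. For blocks $B_i,B_j$, $|B_i\cap B_j|$ is the number of points incident with both. An automorphism group of $\mathcal{D}$ is a group of incidence-preserving bijections (points to points, blocks to blocks) of $\mathcal{D}$. If $G$ has point orbits $\mathcal{V}_1,\ldots,\mathcal{V}_n$ and block orbits $\mathcal{B}_1,\ldots,\mathcal{B}_m$, the orbit matrix is the $m\times n$ matrix $[a_{i,j}]$ where $a_{i,j}$ is the number of points of $\mathcal{V}_j$ incident with a block of $\mathcal{B}_i$ (independent of the chosen block); its entries are viewed in the field under consideration. $I_m$ is the identity matrix, $\mathbf{1}$ the all-one column, and $[X,Y,\ldots]$ denotes horizontal concatenation. For $c\in\mathbb{F}_p$, viewed in $\mathbb{F}$, $\sqrt{c}$ denotes an element of $\mathbb{F}$ whose square is $c$. An $[N,K]$ code has length $N$ and dimension $K$. A code $C\subseteq\mathbb{F}^N$ is self-orthogonal if $C\subseteq C^\perp$ and self-dual if $C=C^\perp$, where $C^\perp$ is the dual under the standard (bilinear) inner product. *)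

(* Defs.v *)
From HB Require Import structures.
From mathcomp Require Import all_boot all_order all_algebra all_fingroup.

Set Implicit Arguments.
Unset Strict Implicit.
Unset Printing Implicit Defensive.

Import GRing.Theory.
Local Open Scope ring_scope.

Section Designs.

(* Points and blocks are separate types, so distinct blocks may be incident  *)
(* with the same points.                                                     *)
Variables (P B : finType) (inc : P -> B -> bool).

Definition block_points (b : B) : {set P} := [set x | inc x b].
Definition point_blocks (x : P) : {set B} := [set b | inc x b].

Definition one_design (v k r : nat) : Prop :=
  [/\ #|P| = v,
      forall b, #|block_points b| = k &
      forall x, #|point_blocks x| = r].

Definition design_aut : {set {perm P} * {perm B}} :=
  [set g : {perm P} * {perm B} |
     [forall x, forall b, inc (g.1 x) (g.2 b) == inc x b]].

Definition point_to (x : P) (g : {perm P} * {perm B}) : P := g.1 x.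
Definition block_to (b : B) (g : {perm P} * {perm B}) : B := g.2 b.

Fact point_to1 : point_to^~ 1%g =1 id.
Proof. by move=> x; rewrite /point_to perm1. Qed.
Fact point_toM x : act_morph point_to x.
Proof. by move=> g h; rewrite /point_to permM. Qed.
Fact block_to1 : block_to^~ 1%g =1 id.
Proof. by move=> b; rewrite /block_to perm1. Qed.
Fact block_toM b : act_morph block_to b.
Proof. by move=> g h; rewrite /block_to permM. Qed.

Canonical point_action := TotalAction point_to1 point_toM.
Canonical block_action := TotalAction block_to1 block_toM.

Definition point_orbits (G : {set {perm P} * {perm B}}) : {set {set P}} :=
  [set orbit point_action G x | x : P].
Definition block_orbits (G : {set {perm P} * {perm B}}) : {set {set B}} :=
  [set orbit block_action G b | b : B].

(* BO and PO list the block and point orbits. The entry is computed from an  *)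
(* arbitrary block of BO i; orbit_mxE shows that any other block of BO i     *)
(* gives the same value.                                                     *)
Definition orbit_mx (R : pzRingType) (m n : nat)
    (BO : 'I_m -> {set B}) (PO : 'I_n -> {set P}) : 'M[R]_(m, n) :=
  \matrix_(i, j)
    (if [pick b in BO i] is Some b then #|PO j :&: block_points b|%:R else 0).

Lemma orbit_mxE (R : pzRingType) (m n : nat)
    (G : {group {perm P} * {perm B}})
    (BO : 'I_m -> {set B}) (PO : 'I_n -> {set P}) i j b :
    G \subset design_aut -> BO i \in block_orbits G ->
    PO j \in point_orbits G -> b \in BO i ->
  orbit_mx R BO PO i j = #|PO j :&: block_points b|%:R.
Proof.
move=> /subsetP sGA /imsetP[b0 _ eBO] /imsetP[x0 _ ePO] bi.
rewrite mxE; case: pickP => [c ci | /(_ b)]; last by rewrite bi.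
have [g gG <-] : exists2 g, g \in G & block_to b g = c.
  apply/(@orbitP _ _ _ block_action); move: bi ci.
  by rewrite !eBO orbit_sym => bi ci; apply: orbit_trans ci bi.
have invg x : inc (g.1 x) (g.2 b) = inc x b.
  by have := sGA _ gG; rewrite inE => /forallP/(_ x)/forallP/(_ b)/eqP.
have memg x : (g.1 x \in PO j) = (x \in PO j).
  by rewrite ePO -[g.1 x]/(point_action x g) orbit_actr.
rewrite -[in RHS](card_imset _ (@perm_inj _ g.1)); congr (_%:R).
apply: eq_card => y; rewrite -[y](permKV g.1) mem_imset; last exact: perm_inj.
by rewrite !inE memg invg.
Qed.

End Designs.

Section Codes.

Variables (F : finFieldType) (N : nat).

Definition dotv (x y : 'rV[F]_N) : F := \sum_(i < N) x 0 i * y 0 i.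

Definition dual_code (C : {vspace 'rV[F]_N}) : {set 'rV[F]_N} :=
  [set x | [forall y, (y \in C) ==> (dotv x y == 0)]].

Definition self_orthogonal (C : {vspace 'rV[F]_N}) : Prop :=
  {subset C <= dual_code C}.

Definition self_dual (C : {vspace 'rV[F]_N}) : Prop := C =i dual_code C.

Definition row_code (m : nat) (M : 'M[F]_(m, N)) : {vspace 'rV[F]_N} :=
  <<[seq row i M | i : 'I_m]>>%VS.

End Codes.

(* The canonical map from 'F_p to K; a ring morphism only when K has         *)
(* characteristic p.                                                         *)
Definition of_Fp {p : nat} (K : pzRingType) (c : 'F_p) : K :=
  (nat_of_ord c)%:R.

Definition is_square (K : finFieldType) (c : K) : bool :=
  [exists x : K, x ^+ 2 == c].

(* Main.v *)
Require Import Defs.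
From HB Require Import structures.
From mathcomp Require Import all_boot all_order all_algebra all_fingroup.
From mathcomp Require Import finfield.

Set Implicit Arguments.
Unset Strict Implicit.
Unset Printing Implicit Defensive.

Import GRing.Theory.
Local Open Scope ring_scope.

(** Everything follows from the Gram matrix of the orbit matrix [O], which over
    a field of characteristic [p] is [O O^T = w d J - d I], where [J] is the
    all-one matrix ([orbit_mx_gram]).

    To see this, fix a block [b] of the [i]-th orbit and sum [|b meet c|] over
    the blocks [c] of the [i']-th orbit. By hypothesis the result is [w d] if
    [i] and [i'] differ, and [k + (w - 1) d = (w - 1) d] if they agree. Counting
    the same flags point by point, a point of the [j]-th orbit lies on a
    constant number of blocks of the [i']-th orbit, and since point and block
    orbits have the same length [w], that number is the entry [O i' j]
    ([orbit_incidence_balance]). So the sum is also [\sum_j O i j * O i' j]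
    ([sum_block_meets]).

    Appending [s I] with [s^2 = d] adds [d I] to the Gram matrix, and appending
    a constant column [t] with [t^2 = - w d] adds [- w d J]; the rows of the
    extended matrix are then pairwise orthogonal, and each of them to itself.
    In case (a) the term [w d J] is already zero; in case (b), [w = 1] in the
    field, so [w d] may replace [d]. As [s] is nonzero the block [s I] makes the
    rows independent, whence the dimension, and an [m]-dimensional
    self-orthogonal code of length [2 m] is self-dual for dimension reasons
    ([self_dual_row_code]).

    The required square roots exist in the stated field because all the
    radicands come from the prime field. By Euler's criterion, for an integer
    the property of being a square in a finite field depends only on the
    characteristic and the cardinality ([is_square_same_card]), and an element
    of a field of order [q] becomes a square over the field of order [q^2]
    ([is_square_card_sqr]). *)

(** * Square roots of integers in finite fields *)

Section SquareRoots.

Lemma double_half_pred_odd n : odd n -> (2 * n.-1./2)%N = n.-1.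
Proof. by case: n => // n evenn; rewrite mul2n even_halfK. Qed.

Lemma expf_card_pred (F : finFieldType) (x : F) :
  x != 0 -> x ^+ #|F|.-1 = 1.
Proof.
move=> x_neq0; apply: (mulfI x_neq0).
by rewrite -exprS prednK ?expf_card ?mulr1 //; apply/card_gt0P; exists 0.
Qed.

(** The substantial direction of Euler's criterion: the hypothesis makes
    ['X^2 - c] a divisor of ['X^#|F| - 'X], which splits into linear factors
    over [F]. *)
Lemma is_square_of_half_power (F : finFieldType) (c : F) :
  odd #|F| -> c ^+ #|F|.-1./2 = 1 -> is_square c.
Proof.
move=> oddF; set h := #|F|.-1./2 => ch1.
have cardE : #|F| = (2 * h).+1.
  by rewrite double_half_pred_odd // prednK //; case: #|F| oddF.
have : 'X^2 - c%:P %| \prod_(x : F) ('X - x%:P).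
  rewrite -finField_genPoly cardE.
  have -> : 'X^((2 * h).+1) - 'X = 'X * ('X^(2 * h) - 1) :> {poly F}.
    by rewrite exprS mulrBr mulr1.
  apply: dvdp_mull.
  by rewrite exprM -polyC1 -ch1 polyC_exp subrXX dvdp_mulr.
(* The divisor has degree two, so it has at least one of the linear factors. *)
case/dvdp_prod_XsubC=> msk; case: (mask _ _) => [|x s].
  by move/eqp_size; rewrite big_nil size_polyC oner_eq0 size_XnsubC.
rewrite big_cons => /eqp_root/(_ x); rewrite rootM root_XsubC eqxx /=.
rewrite /root !hornerE subr_eq0 => xc.
by apply/existsP; exists x.
Qed.

Lemma euler_criterion (F : finFieldType) (c : F) :
  odd #|F| -> c != 0 -> is_square c = (c ^+ #|F|.-1./2 == 1).
Proof.
move=> oddF c_neq0; apply/idP/eqP => [|/is_square_of_half_power]; last exact.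
case/existsP=> x /eqP xc; rewrite -xc -exprM double_half_pred_odd //.
rewrite expf_card_pred //; apply: contraNneq c_neq0 => x0.
by rewrite -xc x0 expr0n.
Qed.

Lemma is_square_even_card (F : finFieldType) (c : F) :
  ~~ odd #|F| -> is_square c.
Proof.
move=> evenF; apply/existsP; exists (c ^+ #|F|./2).
by rewrite -exprM muln2 even_halfK // expf_card.
Qed.

Lemma is_square0 (F : finFieldType) : is_square (0 : F).
Proof. by apply/existsP; exists 0; rewrite expr0n. Qed.

Variables (p : nat) (K F : finFieldType).
Hypotheses (pK : p \in [pchar K]) (pF : p \in [pchar F]).

Lemma natr_eq0_same_pchar (a : nat) : (a%:R == 0 :> F) = (a%:R == 0 :> K).
Proof. by rewrite -(dvdn_pcharf pF) (dvdn_pcharf pK). Qed.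

Lemma natrX_eq1_same_pchar (a e : nat) :
  (a%:R ^+ e == 1 :> F) = (a%:R ^+ e == 1 :> K).
Proof.
have [-> | a_gt0] := posnP a.
  by case: e => [|e]; rewrite ?eqxx // !expr0n !(eq_sym 0) !oner_eq0.
have natB1 (L : pzRingType) : a%:R ^+ e - 1 = (a ^ e - 1)%:R :> L.
  by rewrite natrB ?expn_gt0 ?a_gt0 // natrX.
by rewrite -[LHS]subr_eq0 -[RHS]subr_eq0 !natB1 natr_eq0_same_pchar.
Qed.

Lemma is_square_same_card (a : nat) :
  #|F| = #|K| -> is_square (a%:R : K) -> is_square (a%:R : F).
Proof.
move=> cardFK.
have [oddF|] := boolP (odd #|F|); last by move/is_square_even_card.
have [/eqP -> | a_neq0] := boolP (a%:R == 0 :> F); first by rewrite is_square0.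
have aK_neq0 : a%:R != 0 :> K by rewrite -natr_eq0_same_pchar.
by rewrite !euler_criterion -?cardFK // natrX_eq1_same_pchar.
Qed.

(** The exponent [(q^2 - 1) / 2] in Euler's criterion is a multiple of [q - 1],
    which already annihilates the units of a field of order [q]. *)
Lemma is_square_card_sqr (a : nat) :
  #|F| = (#|K| ^ 2)%N -> is_square (a%:R : F).
Proof.
move=> cardFK.
have [oddF|] := boolP (odd #|F|); last exact: is_square_even_card.
have [/eqP -> | a_neq0] := boolP (a%:R == 0 :> F); first by rewrite is_square0.
have oddK : odd #|K| by move: oddF; rewrite cardFK oddX.
rewrite euler_criterion // natrX_eq1_same_pchar cardFK.
have -> : (#|K| ^ 2).-1./2 = (#|K|.-1 * #|K|.+1./2)%N.
  rewrite -[RHS]doubleK doubleMr even_halfK ?negbK //.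
  by rewrite -(addn1 #|K|) -!subn1 -subn_sqr exp1n.
by rewrite exprM expf_card_pred ?expr1n // -natr_eq0_same_pchar.
Qed.

Lemma natr_sqrt_exists (sq : bool) (a : nat) :
    #|F| = (if sq then #|K| else (#|K| ^ 2)%N) ->
    (sq -> is_square (a%:R : K)) ->
  exists s : F, s ^+ 2 = a%:R.
Proof.
move=> cardF sqK; suff /existsP[s /eqP <-] : is_square (a%:R : F) by exists s.
case: sq sqK cardF => [/(_ isT) sqK cardF|_ cardF].
  exact: is_square_same_card.
exact: is_square_card_sqr.
Qed.

End SquareRoots.

Lemma of_Fp_nat (p : nat) (K : pzRingType) (a : nat) :
  prime p -> p%:R = 0 :> K -> of_Fp K (a%:R : 'F_p) = a%:R.
Proof.
move=> p_prime p0; rewrite /of_Fp val_Fp_nat // [in RHS](divn_eq a p).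
by rewrite natrD natrM p0 mulr0 add0r.
Qed.

(** * Codes spanned by the rows of a matrix *)

Section RowCodes.

Variables (F : finFieldType) (m N : nat) (M : 'M[F]_(m, N)).

Lemma row_code_limg : row_code M = limg (linfun (mulmxr M)).
Proof.
apply/vspaceP => x; apply/idP/idP.
  apply/subvP/span_subvP: x => _ /imageP[i _ ->].
  by apply/memv_imgP; exists (delta_mx 0 i); rewrite ?memvf // lfunE /= -rowE.
case/memv_imgP=> u _ ->; rewrite lfunE /= mulmx_sum_row.
by apply: memv_suml => i _; apply/memvZ/memv_span/image_f.
Qed.

Lemma mem_row_code x : (x \in row_code M) = (x <= M)%MS.
Proof.
rewrite row_code_limg; apply/memv_imgP/submxP => [[u _ ->]|[u ->]].
  by exists u; rewrite lfunE.
by exists u; rewrite ?memvf // lfunE.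
Qed.

Lemma dotv_eq0 (x y : 'rV[F]_N) : (dotv x y == 0) = (x *m y^T == 0).
Proof.
rewrite [X in _ = (X == _)]mx11_scalar -scalemx1 scalemx_eq0.
rewrite -[1%:M == _]/(1 == 0 :> 'M_1) oner_eq0 orbF mxE /dotv.
by congr (_ == 0); apply: eq_bigr => i _; rewrite mxE.
Qed.

Lemma mem_dual_row_code x : (x \in dual_code (row_code M)) = (x *m M^T == 0).
Proof.
rewrite inE; apply/forallP/eqP => [x_dual|xM0 y].
  apply/trmx_inj/row_matrixP => i; rewrite trmx_mul trmxK trmx0 row0.
  apply/trmx_inj; rewrite row_mul trmx_mul trmxK trmx0; apply/eqP.
  by rewrite -dotv_eq0; apply: (implyP (x_dual _)); rewrite mem_row_code row_sub.
apply/implyP; rewrite mem_row_code => /submxP[u ->].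
by rewrite dotv_eq0 trmx_mul mulmxA xM0 mul0mx.
Qed.

Lemma self_orthogonal_row_code : M *m M^T = 0 -> self_orthogonal (row_code M).
Proof.
move=> MMt0 x; rewrite mem_row_code mem_dual_row_code => /submxP[u ->].
by rewrite -mulmxA MMt0 mulmx0.
Qed.

Lemma dim_row_code : row_free M -> \dim (row_code M) = m.
Proof.
move=> freeM; rewrite row_code_limg limg_dim_eq ?dimvf /dim /= ?mul1n //.
apply/eqP; rewrite -subv0; apply/subvP => u.
rewrite memv_cap memv_ker lfunE /= => /andP[_].
by rewrite mulmx_free_eq0 // memv0.
Qed.

(** The dual code is the kernel of [M^T]; it contains the row space of [M] and
    has the same rank [N - m = m]. *)
Lemma self_dual_row_code :
  row_free M -> M *m M^T = 0 -> N = (m + m)%N -> self_dual (row_code M).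
Proof.
move=> freeM MMt0 NE x; rewrite mem_dual_row_code mem_row_code -sub_kermx.
have sMk : (M <= kermx M^T)%MS by apply/sub_kermxP.
have /mxrank_leqif_sup[_ ] := sMk.
rewrite mxrank_ker mxrank_tr (eqP freeM) {1}NE addKn eqxx => /esym skM.
by apply/idP/idP => /submx_trans; apply.
Qed.

End RowCodes.

Lemma row_free_row_mxl (F : fieldType) (m n1 n2 : nat)
    (A : 'M[F]_(m, n1)) (A' : 'M[F]_(m, n2)) :
  row_free A -> row_free (row_mx A A').
Proof.
case/row_freeP=> C AC1; apply/row_freeP; exists (col_mx C 0).
by rewrite mul_row_col mulmx0 addr0.
Qed.

Lemma row_free_scalar_mx (F : fieldType) (m : nat) (s : F) :
  s != 0 -> row_free (s%:M : 'M_m).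
Proof.
move=> s_neq0; apply/row_freeP; exists s^-1%:M.
by rewrite -scalar_mxM divff.
Qed.

Section ExtendedCodes.

Variables (F : finFieldType) (m n : nat) (O : 'M[F]_(m, n)) (s : F).
Hypothesis s_neq0 : s != 0.

Lemma scalar_extension_code (C := row_code (row_mx s%:M O)) :
    O *m O^T = - (s ^+ 2)%:M ->
  [/\ self_orthogonal C, \dim C = m & m = n -> self_dual C].
Proof.
move=> OOt; have freeM := row_free_row_mxl O (row_free_scalar_mx m s_neq0).
have MMt0 : row_mx s%:M O *m (row_mx s%:M O)^T = 0.
  by rewrite tr_row_mx mul_row_col tr_scalar_mx -scalar_mxM -expr2 OOt subrr.
split=> [||mn]; [exact: self_orthogonal_row_code | exact: dim_row_code |].
by apply: self_dual_row_code => //; rewrite -mn.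
Qed.

Lemma bordered_extension_code (t : F)
    (C := row_code (row_mx (row_mx s%:M O) (const_mx t : 'cV[F]_m))) :
    O *m O^T = const_mx (- t ^+ 2) - (s ^+ 2)%:M ->
  self_orthogonal C /\ \dim C = m.
Proof.
move=> OOt; split; last first.
  by apply/dim_row_code/row_free_row_mxl/row_free_row_mxl/row_free_scalar_mx.
have ttE : (const_mx t : 'cV[F]_m) *m (const_mx t : 'cV_m)^T = const_mx (t ^+ 2).
  by apply/matrixP => i j; rewrite !mxE big_ord1 !mxE.
apply: self_orthogonal_row_code; rewrite !tr_row_mx !mul_row_col tr_scalar_mx.
rewrite -scalar_mxM -expr2 OOt ttE addrCA subrr addr0.
by apply/matrixP => i j; rewrite !mxE addNr.
Qed.

End ExtendedCodes.

(** * Point and block orbits *)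

Section TacticalDecomposition.

Variables (P B : finType) (inc : P -> B -> bool).
Variable G : {group {perm P} * {perm B}}.
Hypothesis G_aut : G \subset design_aut inc.

Local Notation porbit x := (orbit (point_action P B) G x).
Local Notation borbit b := (orbit (block_action P B) G b).

Lemma sum_card_flags (X : {set P}) (Y : {set B}) :
  (\sum_(x in X) #|Y :&: point_blocks inc x| =
   \sum_(c in Y) #|X :&: block_points inc c|)%N.
Proof.
transitivity (\sum_(x in X) \sum_(c in Y | inc x c) 1)%N.
  apply: eq_bigr => x _; rewrite -sum1_card; apply: eq_bigl => c.
  by rewrite !inE.
rewrite (exchange_big_dep (mem Y)) /=; last by move=> x c _ /andP[].
apply: eq_bigr => c cY; rewrite -sum1_card; apply: eq_bigl => x.
by rewrite !inE cY.
Qed.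

Lemma inc_aut g x b : g \in G -> inc (g.1 x) (g.2 b) = inc x b.
Proof.
by move/(subsetP G_aut); rewrite inE => /forallP/(_ x)/forallP/(_ b)/eqP.
Qed.

Lemma card_block_orbit_meet b x y : y \in porbit x ->
  #|borbit b :&: point_blocks inc y| = #|borbit b :&: point_blocks inc x|.
Proof.
case/orbitP=> g gG <-; rewrite -[RHS](card_imset _ (@perm_inj _ g.2)).
apply: eq_card => c; rewrite -[c](permKV g.2) mem_imset; last exact: perm_inj.
rewrite !inE inc_aut //; congr (_ && _).
by rewrite -[X in X \in _]/(block_action P B _ g) orbit_actr.
Qed.

Lemma card_point_orbit_meet x b c : c \in borbit b ->
  #|porbit x :&: block_points inc c| = #|porbit x :&: block_points inc b|.
Proof.
case/orbitP=> g gG <-; rewrite -[RHS](card_imset _ (@perm_inj _ g.1)).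
apply: eq_card => y; rewrite -[y](permKV g.1) mem_imset; last exact: perm_inj.
rewrite !inE inc_aut //; congr (_ && _).
by rewrite -[X in X \in _]/(point_action P B _ g) orbit_actr.
Qed.

(** Both sides count the flags between the orbit of [x] and that of [b]. For
    orbits of equal length it says that [x] is on as many blocks of the orbit
    of [b] as [b] has points in the orbit of [x]. *)
Lemma orbit_incidence_balance x b :
  (#|porbit x| * #|borbit b :&: point_blocks inc x| =
   #|borbit b| * #|porbit x :&: block_points inc b|)%N.
Proof.
rewrite -!sum_nat_const.
rewrite -(eq_bigr _ (fun y => @card_block_orbit_meet b x y)) sum_card_flags.
by apply: eq_bigr => c; apply: card_point_orbit_meet.
Qed.

Lemma point_orbits_partition : partition (point_orbits G) [set: P].
Proof.
have -> : point_orbits G = [set porbit x | x in [set: P]].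
  by apply/setP => X; apply/imsetP/imsetP => -[x _ ->]; exists x.
apply: orbit_partition; apply/subsetP => g _; rewrite !inE.
by apply/subsetP => x _; rewrite !inE.
Qed.

Lemma sum_block_meets (n w : nat) (PO : 'I_n -> {set P}) (b b' : B) :
    injective PO -> [set PO j | j : 'I_n] = point_orbits G ->
    (forall j, #|PO j| = w) -> #|borbit b'| = w ->
  (\sum_(c in borbit b') #|block_points inc b :&: block_points inc c| =
   \sum_j #|PO j :&: block_points inc b| * #|PO j :&: block_points inc b'|)%N.
Proof.
move=> PO_inj PO_orbits PO_w BO_w.
have w_gt0 : (0 < w)%N.
  by rewrite -BO_w card_gt0; apply/set0Pn; exists b'; apply: orbit_refl.
have partP := point_orbits_partition; rewrite -PO_orbits in partP.
rewrite -sum_card_flags big_mkcond /=.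
rewrite (eq_bigl (mem [set: P])) => [|x]; last by rewrite /= inE.
rewrite (set_partition_big _ partP) big_imset /=; last by move=> i j _ _ /PO_inj.
apply: eq_bigr => j _; rewrite -big_mkcondr -sum_nat_const /=.
rewrite [RHS](eq_bigl [pred y | (y \in PO j) && (y \in block_points inc b)]);
  last by move=> y; rewrite !inE.
apply: eq_bigr => y /andP[yPj _]; apply/eqP; rewrite -(eqn_pmul2l w_gt0).
have PjE : PO j = porbit y.
  have /imsetP[x _ PjE] : PO j \in point_orbits G by rewrite -PO_orbits imset_f.
  by rewrite PjE in yPj *; apply/esym/orbit_eqP.
by rewrite -{1}(PO_w j) -BO_w PjE orbit_incidence_balance.
Qed.

End TacticalDecomposition.

(** The entry [(i, i')] sums the intersection numbers of one block [b] of the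
    [i]-th orbit with the [w] blocks of the [i']-th. Each contributes [d],
    except that on the diagonal [b] itself contributes its size, which is zero
    in [R]. *)
Lemma orbit_mx_gram (P B : finType) (inc : P -> B -> bool) (R : pzRingType)
    (d : R) (G : {group {perm P} * {perm B}}) (n m w : nat)
    (PO : 'I_n -> {set P}) (BO : 'I_m -> {set B}) :
    (forall b, #|block_points inc b|%:R = 0 :> R) ->
    (forall b1 b2, b1 != b2 ->
       #|block_points inc b1 :&: block_points inc b2|%:R = d) ->
    G \subset design_aut inc ->
    injective PO -> [set PO j | j : 'I_n] = point_orbits G ->
    (forall j, #|PO j| = w) ->
    injective BO -> [set BO i | i : 'I_m] = block_orbits G ->
    (forall i, #|BO i| = w) ->
  orbit_mx inc R BO PO *m (orbit_mx inc R BO PO)^T =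
  const_mx (w%:R * d) - d%:M.
Proof.
move=> size0 meetd G_aut PO_inj PO_orbits PO_w BO_inj BO_orbits BO_w.
have BO_orb i : BO i \in block_orbits G by rewrite -BO_orbits imset_f.
have PO_orb j : PO j \in point_orbits G by rewrite -PO_orbits imset_f.
have BOE i b : b \in BO i -> BO i = orbit (block_action P B) G b.
  have /imsetP[c _ ->] := BO_orb i.
  by move=> bc; apply/esym/orbit_eqP.
have BO_neq0 i : exists b, b \in BO i.
  by have /imsetP[b _ ->] := BO_orb i; exists b; apply: orbit_refl.
apply/matrixP => i i'; rewrite [LHS]mxE.
have -> : (const_mx (w%:R * d) - d%:M : 'M[R]_m) i i' =
          w%:R * d - d *+ (i == i') by rewrite !mxE.
have [[b bi] [b' bi']] := (BO_neq0 i, BO_neq0 i').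
transitivity
    (\sum_(c in BO i') #|block_points inc b :&: block_points inc c|%:R : R).
  rewrite -natr_sum (BOE _ _ bi').
  rewrite (sum_block_meets G_aut b PO_inj PO_orbits PO_w) -?(BOE _ _ bi') //.
  rewrite natr_sum; apply: eq_bigr => j _; rewrite natrM [(_^T) _ _]mxE.
  rewrite (orbit_mxE R G_aut (BO_orb i) (PO_orb j) bi).
  by rewrite (orbit_mxE R G_aut (BO_orb i') (PO_orb j) bi').
have [eii|ii'] := eqVneq i i'; last first.
  rewrite subr0 -(BO_w i') mulr_natl -sumr_const; apply: eq_bigr => c ci'.
  apply: meetd; apply: contraNneq ii' => bc; apply/eqP/BO_inj.
  by rewrite (BOE _ _ bi) bc -(BOE _ _ ci').
rewrite eii in bi; rewrite (bigD1 b) //= setIid size0 add0r.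
rewrite -(BO_w i') (cardD1 b) bi mulr1n natrD mulrDl mul1r [d + _]addrC addrK.
rewrite mulr_natl -sumr_const.
by apply: eq_big => [c|c /andP[_ cb]]; rewrite ?inE 1?andbC // meetd // eq_sym.
Qed.

(** * The codes of the design *)

Theorem theorem11
  (p l : nat) (p_prime : prime p) (l_gt0 : (0 < l)%N)
  (Fq : finFieldType) (card_Fq : #|Fq| = (p ^ l)%N)
  (P B : finType) (inc : P -> B -> bool) (v k r : nat)
  (design : one_design inc v k r)
  (d : 'F_p) (d_neq0 : d != 0)
  (p_dvd_k : (p %| k)%N)
  (meet_d : forall b1 b2 : B, b1 != b2 ->
     #|block_points inc b1 :&: block_points inc b2|%:R = d)
  (G : {group {perm P} * {perm B}}) (G_aut : G \subset design_aut inc)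
  (n m w : nat)
  (PO : 'I_n -> {set P}) (PO_inj : injective PO)
  (PO_orbits : [set PO j | j : 'I_n] = point_orbits G)
  (PO_length : forall j, #|PO j| = w)
  (BO : 'I_m -> {set B}) (BO_inj : injective BO)
  (BO_orbits : [set BO i | i : 'I_m] = block_orbits G)
  (BO_length : forall i, #|BO i| = w) :
  [/\ (* (a) *)
      (p %| w)%N ->
      forall F : finFieldType,
        #|F| = (if is_square (of_Fp Fq d) then #|Fq| else (#|Fq| ^ 2)%N) ->
        (exists s : F, s ^+ 2 = of_Fp F d) /\
        forall s : F, s ^+ 2 = of_Fp F d ->
          let C := row_code (row_mx s%:M (orbit_mx inc F BO PO)) in
          [/\ self_orthogonal C, \dim C = m & m = n -> self_dual C],
      (* (b) *)
      (p%:Z %| w%:Z - 1)%Z ->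
      forall F : finFieldType,
        #|F| = (if is_square (w%:R * of_Fp Fq d) &&
                   is_square (- (w%:R * of_Fp Fq d))
                then #|Fq| else (#|Fq| ^ 2)%N) ->
        [/\ exists s : F, s ^+ 2 = w%:R * of_Fp F d,
            exists t : F, t ^+ 2 = - (w%:R * of_Fp F d) &
            forall s t : F,
              s ^+ 2 = w%:R * of_Fp F d -> t ^+ 2 = - (w%:R * of_Fp F d) ->
              let C := row_code
                (row_mx (row_mx s%:M (orbit_mx inc F BO PO))
                        (const_mx t : 'cV[F]_m)) in
              self_orthogonal C /\ \dim C = m] &
      (* (c) *)
      ~~ (p %| w)%N -> ~~ (p%:Z %| w%:Z - 1)%Z ->
      forall F : finFieldType,
        #|F| = (if is_square (of_Fp Fq d) &&
                   is_square (- (w%:R * of_Fp Fq d))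
                then #|Fq| else (#|Fq| ^ 2)%N) ->
        [/\ exists s : F, s ^+ 2 = of_Fp F d,
            exists t : F, t ^+ 2 = - (w%:R * of_Fp F d) &
            forall s t : F,
              s ^+ 2 = of_Fp F d -> t ^+ 2 = - (w%:R * of_Fp F d) ->
              let C := row_code
                (row_mx (row_mx s%:M (orbit_mx inc F BO PO))
                        (const_mx t : 'cV[F]_m)) in
              self_orthogonal C /\ \dim C = m]].
Proof.
have pq := card_finPcharP card_Fq p_prime.
have pF e (F : finFieldType) :
    #|F| = (if e then #|Fq| else #|Fq| ^ 2)%N -> p \in [pchar F].
  case: e => [|cF]; first by rewrite card_Fq => /card_finPcharP; apply.
  by apply: (@card_finPcharP _ _ (l * 2)) => //; rewrite cF card_Fq expnM.
have d0 (F : finFieldType) : p \in [pchar F] -> of_Fp F d != 0.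
  move=> pcF; rewrite /of_Fp -(dvdn_pcharf pcF).
  apply: contra d_neq0; rewrite -{2}(natr_Zp d).
  by rewrite (dvdn_pcharf (pchar_Fp p_prime)).
have gram (F : finFieldType) : p \in [pchar F] ->
    orbit_mx inc F BO PO *m (orbit_mx inc F BO PO)^T =
      const_mx (w%:R * of_Fp F d) - (of_Fp F d)%:M.
  have [_ block_k _] := design.
  move=> pcF; apply: (orbit_mx_gram _ _ G_aut) => // [b | b1 b2 /meet_d <-].
    by apply/eqP; rewrite block_k -(dvdn_pcharf pcF).
  by rewrite of_Fp_nat ?(pcharf0 pcF).
have wdE (F : finFieldType) : w%:R * of_Fp F d = (w * d)%:R by rewrite natrM.
(* In characteristic p, the number p - 1 represents -1. *)
have NwdE (F : finFieldType) : p \in [pchar F] ->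
    - (w%:R * of_Fp F d) = (p.-1 * (w * d))%:R.
  move=> pcF; rewrite natrM -subn1 natrB ?prime_gt0 // (pcharf0 pcF) sub0r.
  by rewrite mulN1r natrM.
have sqr_neq0 (F : finFieldType) (s : F) :
    p \in [pchar F] -> s ^+ 2 = of_Fp F d -> s != 0.
  by move=> pcF s2; rewrite -sqrf_eq0 s2 d0.
have roots e (F : finFieldType) a : #|F| = (if e then #|Fq| else #|Fq| ^ 2)%N ->
    (e -> is_square (a%:R : Fq)) -> exists s : F, s ^+ 2 = a%:R.
  by move=> cF; apply: (natr_sqrt_exists pq (pF _ _ cF) cF).
have bordered (F : finFieldType) (s t : F) : p \in [pchar F] ->
    s ^+ 2 = of_Fp F d -> t ^+ 2 = - (w%:R * of_Fp F d) ->
    let C := row_code (row_mx (row_mx s%:M (orbit_mx inc F BO PO))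
                              (const_mx t : 'cV[F]_m)) in
    self_orthogonal C /\ \dim C = m.
  move=> pcF s2 t2; apply: bordered_extension_code; first exact: sqr_neq0 s2.
  by rewrite t2 s2 opprK gram.
split.
- move=> p_w F cF; have pcF := pF _ _ cF.
  split; first exact: roots cF _.
  move=> s s2; apply: scalar_extension_code; first exact: sqr_neq0 s2.
  have w0 : w%:R = 0 :> F by apply/eqP; rewrite -(dvdn_pcharf pcF).
  by rewrite gram // w0 mul0r s2; apply/matrixP => i j; rewrite !mxE add0r.
- move=> p_w1 F cF; have pcF := pF _ _ cF.
  have w1 : w%:R = 1 :> F.
    case/dvdzP: p_w1 => z /eqP; rewrite subr_eq => /eqP wE.
    have := congr1 (fun y : int => y%:~R : F) wE.
    by rewrite rmorphD rmorphM /= -!pmulrn (pcharf0 pcF) mulr0 add0r.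
  split=> [||s t s2].
  + by rewrite wdE; apply: roots cF _ => /andP[]; rewrite wdE.
  + by rewrite (NwdE _ pcF); apply: roots cF _ => /andP[_]; rewrite (NwdE _ pq).
  by apply: bordered => //; rewrite s2 w1 mul1r.
- move=> _ _ F cF; have pcF := pF _ _ cF.
  split=> [||s t]; last exact: bordered.
  + by apply: roots cF _ => /andP[].
  by rewrite (NwdE _ pcF); apply: roots cF _ => /andP[_]; rewrite (NwdE _ pq).
Qed.
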